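(* Cartesian products, finite or infinite, of Ramsey algebras need not be Ramsey. That is: (i) there exists a finite family of infinite Ramsey algebras of a common language whose Cartesian product is not a Ramsey algebra; and (ii) there exists an infinite family of infinite Ramsey algebras of a common language whose Cartesian product is not a Ramsey algebra.
   Context: An algebra $\mathcal{A}=(A,\mathcal{F})$ consists of a set $A$ and a family $\mathcal{F}$ of finitary operations $f:A^n\to A$ on $A$; it is infinite if $A$ is infinite. When $\mathcal{L}$ is a set of function symbols (a purely functional language), an algebra of the language $\mathcal{L}$ is an $\mathcal{L}$-structure, $\mathcal{F}$ being the family of interpretations of the symbols. The Cartesian product of a family of algebras of the same language $\mathcal{L}$ has as universe the Cartesian product of the universes, and each function symbol is interpreted coordinatewise. An $n$-ary $f$ is an orderly composition of a family $\mathcal{G}$ of operations if there are a $k$-ary $g\in\mathcal{G}$ and $n_j$-ary $h_j\in\mathcal{G}$ ($1\le j\le k$) with $\sum_{j=1}^k n_j=n$ such that $f(x_1,\dots,x_n)=g(h_1(\bar x_1),\dots,h_k(\bar x_k))$, where $\bar x_1,\dots,\bar x_k$ are the consecutive blocks of $(x_1,\dots,x_n)$ of lengths $n_1,\dots,n_k$. The set $\mathrm{OT}(\mathcal{F})$ of orderly terms over $\mathcal{F}$ is the smallest collection of operations on $A$ that contains $\mathcal{F}\cup\{\mathrm{id}_A\}$ and is closed under orderly composition. For infinite sequences $\vec a,\vec b\in{}^\omega A$, $\vec a$ is a reduction of $\vec b$, written $\vec a\le_{\mathcal{F}}\vec b$, if there are orderly terms $f_j\in\mathrm{OT}(\mathcal{F})$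 and finite subsequences $\vec b_j$ of $\vec b$ ($j\in\omega$) such that $\vec a(j)=f_j(\vec b_j)$ for every $j$ and the concatenation $\vec b_0*\vec b_1*\cdots$ is a subsequence of $\vec b$. Put $\mathrm{FR}_{\mathcal{F}}(\vec b)=\{\vec a(0):\vec a\le_{\mathcal{F}}\vec b\}$. The algebra $(A,\mathcal{F})$ is a Ramsey algebra if for every $\vec b\in{}^\omega A$ and every $X\subseteq A$ there is $\vec a\le_{\mathcal{F}}\vec b$ such that $\mathrm{FR}_{\mathcal{F}}(\vec a)$ is either contained in $X$ or disjoint from $X$. *)

(* Defs.v *)
From mathcomp Require Import all_boot.
From mathcomp Require Import boolp classical_sets cardinality.

Set Implicit Arguments.
Unset Strict Implicit.
Unset Printing Implicit Defensive.

Local Open Scope classical_set_scope.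

Definition op (A : Type) (n : nat) : Type := n.-tuple A -> A.

(* A family of finitary operations, as a set of operations of each arity. *)
Definition opset (A : Type) : Type := forall n : nat, set (op A n).

Definition id_op (A : Type) : op A 1 := fun x => thead x.

(* Every y : n.-tuple A with n = \sum_j m j splits in exactly one way into
   consecutive blocks x j of lengths m j, so the last clause determines f. *)
Definition orderly_composition (A : Type) (G : opset A) (n : nat)
    (f : op A n) : Prop :=
  exists (k : nat) (g : op A k) (m : 'I_k -> nat)
         (h : forall j : 'I_k, op A (m j)),
    [/\ G k g,
        forall j, G (m j) (h j),
        (\sum_(j < k) m j)%N = n &
        forall (x : forall j : 'I_k, (m j).-tuple A) (y : n.-tuple A),
          y = flatten [seq tval (x j) | j <- enum 'I_k] :> seq A ->
          f y = g [tuple h j (x j) | j < k]].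

Definition OT (A : Type) (F : opset A) : opset A :=
  fun n f => forall G : opset A,
    (forall k, F k `<=` G k) ->
    G 1%N (@id_op A) ->
    (forall k (g : op A k), orderly_composition G g -> G k g) ->
    G n f.

(* The concatenation c 0 * c 1 * ... is a subsequence of b.  It may be finite
   (blocks can be empty), in which case only an initial part of the strictly
   increasing index sequence i matters. *)
Definition concat_subsequence (A : Type) (c : nat -> seq A) (b : nat -> A)
    : Prop :=
  exists i : nat -> nat,
    {homo i : p q / (p < q)%N} /\
    forall N : nat,
      let s := flatten (mkseq c N) in s = mkseq (b \o i) (size s).

(* That each bs j is itself a finite subsequence of b follows from the last
   clause. *)
Definition reduction (A : Type) (F : opset A) (a b : nat -> A) : Prop :=
  exists (n : nat -> nat) (f : forall j, op A (n j))
         (bs : forall j, (n j).-tuple A),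
    [/\ forall j, OT F (f j),
        forall j, a j = f j (bs j) &
        concat_subsequence (fun j => tval (bs j)) b].

Definition FR (A : Type) (F : opset A) (b : nat -> A) : set A :=
  [set x | exists a : nat -> A, reduction F a b /\ a 0%N = x].

Definition Ramsey (A : Type) (F : opset A) : Prop :=
  forall (b : nat -> A) (X : set A),
    exists a : nat -> A,
      reduction F a b /\ (FR F a `<=` X \/ FR F a `&` X = set0).

Record language : Type := Language {
  symbol : Type;
  arity : symbol -> nat }.

Record algebra (L : language) : Type := Algebra {
  carrier :> Type;
  interp : forall s : symbol L, op carrier (arity s) }.

Arguments interp {L} a s.

Inductive operations (L : language) (A : algebra L) : opset A :=
  Operation (s : symbol L) : operations (interp A s).

Arguments operations {L} A n _.

Definition Ramsey_algebra (L : language) (A : algebra L) : Prop :=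
  Ramsey (operations A).

Definition infinite_algebra (L : language) (A : algebra L) : Prop :=
  infinite_set [set: A].

Definition product_algebra (L : language) (I : Type) (A : I -> algebra L)
    : algebra L :=
  @Algebra L (forall i : I, A i)
    (fun s x i => interp (A i) s (map_tuple (fun z => z i) x)).

(* Main.v *)
Require Import Defs.
From mathcomp Require Import all_boot.
From mathcomp Require Import boolp classical_sets cardinality.

Local Open Scope classical_set_scope.

(** On nat take two binary operations, the left and the right projection.  All
    orderly terms select one of their arguments, so FR(a) is contained in the
    range of a, and the algebra is Ramsey by the pigeonhole principle.  Now let
    two factors interpret the two symbols in opposite order.  A reduction a of
    the diagonal sequence b(n) = (n, n, ...) has p(a(0)) < q(a(1)) and
    q(a(0)) < p(a(1)) for the coordinates p, q of these factors, because a(0)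
    and a(1) take their coordinates from successive blocks of b.  One operation
    maps (a(0), a(1)) to an element with coordinates p(a(0)), q(a(1)), the other
    to one with coordinates p(a(1)), q(a(0)); so FR(a) is split by the set where
    the first coordinate is smaller than the second. *)

(** The map [p] is there for the product: its operations may take different coordinates from
    different arguments, so they select only after [p] is a fixed coordinate. In a single factor [p]
    is [id]. *)
Definition selective {A : Type} {B : eqType} (p : A -> B) : opset A :=
  fun n f => forall x : n.-tuple A, p (f x) \in [seq p z | z <- x].

Lemma selective_orderly_composition {A : Type} {B : eqType} (p : A -> B)
    (n : nat) (f : op A n) :
  orderly_composition (selective p) f -> selective p n f.
Proof.
move=> [k [g [m [h [gp hp mn fE]]]]] y.
(* Orderly composition determines [f] only on tuples presented as concatenated blocks, so [y] is cut
   back into blocks of lengths [m j]. *)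
pose sh := [seq m j | j <- enum 'I_k].
have shE : sumn sh = size y.
  by rewrite size_tuple -mn sumnE big_map big_enum.
have sz (j : 'I_k) : size (nth [::] (reshape sh y) j) == m j.
  have -> : m j = nth 0 (shape (reshape sh y)) j.
    by rewrite reshapeKl ?shE // (nth_map j) ?size_enum_ord // nth_ord_enum.
  by rewrite (nth_map [::]) // size_reshape size_map size_enum_ord.
pose x j : (m j).-tuple A := Tuple (sz j).
have yE : y = flatten [seq tval (x j) | j <- enum 'I_k] :> seq A.
  rewrite -[LHS](@reshapeKr _ sh) ?shE //; congr flatten.
  apply: (@eq_from_nth _ [::]).
    by rewrite size_reshape !size_map.
  rewrite size_reshape size_map size_enum_ord => i ik.
  by rewrite (nth_map (Ordinal ik)) ?size_enum_ord //= nth_enum_ord.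
rewrite (fE x y yE).
have := gp [tuple h j (x j) | j < k].
rewrite /= -map_comp => /mapP[j _ ->].
rewrite yE map_flatten -map_comp.
apply/flattenP; exists [seq p z | z <- x j]; last exact: hp.
by apply/mapP; exists j; rewrite ?mem_enum.
Qed.

Lemma OT_selective {A : Type} {B : eqType} (p : A -> B) (F : opset A) :
  (forall n, F n `<=` selective p n) -> forall n, @OT A F n `<=` selective p n.
Proof.
move=> Fp n f; apply=> //.
- by case/tupleP => z x; rewrite /id_op theadE mem_head.
- by move=> k g; exact: selective_orderly_composition.
Qed.

Lemma id_OT {A : Type} (F : opset A) : OT F (@id_op A).
Proof. by move=> G. Qed.

Lemma sub_OT {A : Type} (F : opset A) n : F n `<=` @OT A F n.
Proof. by move=> f Ff G FG _ _; exact: FG. Qed.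

Lemma flatten_mkseq_blocks {A : Type} (u : nat -> A) n N :
  flatten (mkseq (fun j => mkseq (fun k => u (j * n + k)) n) N)
  = mkseq u (N * n).
Proof.
elim: N => // N IH; rewrite mkseqS flatten_rcons IH mulSnr.
rewrite /mkseq iotaD map_cat add0n.
by rewrite -[in iota (N * n) n](addn0 (N * n)) iotaDl -map_comp.
Qed.

(** The [j]-th block uses the indices [i (j * n)] up to [i (j * n + n - 1)], so the blocks together
    exhaust the subsequence [b \o i]. The case of [id_op] gives subsequences; the entry at 0 gives
    elements of [FR]. *)
Lemma reduction_blocks {A : Type} (F : opset A) n (f : op A n) (b : nat -> A)
    (i : nat -> nat) :
  OT F f -> {homo i : p q / p < q} ->
  reduction F (fun j => f [tuple b (i (j * n + k)) | k < n]) b.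
Proof.
move=> Ff ihomo.
exists (fun=> n), (fun=> f), (fun j => [tuple b (i (j * n + k)) | k < n]).
split=> //; exists i; split=> // N /=.
have -> : mkseq (fun j => [seq b (i (j * n + k)) | k : 'I_n <- enum 'I_n]) N
    = mkseq (fun j => mkseq (fun k => (b \o i) (j * n + k)) n) N.
  apply: eq_mkseq => j; rewrite /mkseq -val_enum_ord -map_comp.
  exact: eq_map.
by rewrite flatten_mkseq_blocks size_mkseq.
Qed.

Lemma reduction_subsequence {A : Type} (F : opset A) (b : nat -> A)
    (i : nat -> nat) :
  {homo i : p q / p < q} -> reduction F (b \o i) b.
Proof.
move=> ihomo; have := reduction_blocks F _ _ b i (id_OT F) ihomo.
congr (reduction F _ b); apply/funext => j.
by rewrite /id_op /thead tnth_mktuple muln1 addn0.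
Qed.

Lemma FR_operation {A : Type} (F : opset A) n (f : op A n) (b : nat -> A) :
  F n f -> FR F b (f [tuple b k | k < n]).
Proof.
move=> /sub_OT Ff; have := reduction_blocks F _ _ b id Ff.
by move=> /(_ (fun _ _ => id)) red; eexists; split; first exact: red.
Qed.

Lemma selective_FR_range {A : eqType} (F : opset A) (b : nat -> A) :
  (forall n, F n `<=` selective id n) -> FR F b `<=` range b.
Proof.
move=> Fid x [a [[n [f [bs [fF aE [i [_ bsE]]]]]] <-]].
have := OT_selective _ _ Fid _ _ (fF 0) (bs 0).
rewrite -aE map_id; have /= := bsE 1; rewrite cats0 => ->.
by case/mapP => m _ ->; exists (i m).
Qed.

Lemma subsequence_pigeonhole (P : nat -> Prop) :
  exists i : nat -> nat, {homo i : p q / p < q} /\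
    ((forall n, P (i n)) \/ (forall n, ~ P (i n))).
Proof.
(* Either [P] fails from some [N] on, and a shift by [N] suffices, or [P] holds arbitrarily far
   out. *)
have [[N NP]|nP] := pselect (exists N, forall n, N <= n -> ~ P n).
  exists (addn N); split; first by move=> p q; rewrite ltn_add2l.
  by right=> n; apply: NP; rewrite leq_addr.
have /choice[s sP] : forall N, exists n, N <= n /\ P n.
  move=> N; apply: contrapT => H; apply: nP; exists N => n Nn Pn.
  by apply: H; exists n.
exists (fun n => iter n (s \o succn) (s 0)); split.
  by apply: homo_ltn ltn_trans _ => n; have [] := sP (iter n (s \o succn) (s 0)).+1.
by left=> -[|n]; [have [] := sP 0 | have [] := sP (iter n (s \o succn) (s 0)).+1].
Qed.

Lemma selective_Ramsey {A : eqType} (F : opset A) :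
  (forall n, F n `<=` selective id n) -> Ramsey F.
Proof.
move=> Fid b X.
have [i [ihomo iX]] := subsequence_pigeonhole (X \o b).
exists (b \o i); split; first exact: reduction_subsequence.
have sub := selective_FR_range F (b \o i) Fid.
case: iX => iX; [left=> _ /sub[n _ <-]; exact: iX | right].
by rewrite -subset0 => x [/sub[n _ <-]]; exact: iX.
Qed.

Definition two_binary_symbols : language := @Language bool (fun=> 2).

Definition projection_algebra (c : bool) : algebra two_binary_symbols :=
  @Algebra two_binary_symbols nat
    (fun s x => tnth x (if s == c then ord0 else ord_max)).

Lemma Ramsey_projection_algebra (c : bool) :
  Ramsey_algebra (projection_algebra c).
Proof.
apply: (@selective_Ramsey nat) => n _ [s] x /=.
by rewrite map_id mem_tnth.
Qed.

Lemma selective_product_projection (I : Type) (c : I -> bool) (i : I) n :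
  operations (product_algebra (fun i => projection_algebra (c i))) n
    `<=` selective (fun z => z i : nat) n.
Proof.
by move=> _ [s] x; exact: mem_tnth.
Qed.

Lemma reduction_diagonal_lt (I : Type) (c : I -> bool) (i j : I)
    (a : nat -> I -> nat) :
  reduction (operations (product_algebra (fun i => projection_algebra (c i))))
    a (fun n _ => n) -> a 0 i < a 1 j.
Proof.
move=> [n [f [bs [fF aE [u [uhomo bsE]]]]]].
have sel l m : a m l \in [seq z l | z <- bs m].
  rewrite aE; apply: OT_selective (fF m) (bs m).
  exact: selective_product_projection.
have := bsE 2; rewrite /= cats0; set s := size _ => bs01.
(* Terms of the diagonal sequence are constant functions, so every coordinate [l] of the two blocks
   reads off the same increasing indices [u]. *)
have mapE l : [seq z l | z <- bs 0] ++ [seq z l | z <- bs 1] = mkseq u s.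
  by rewrite -map_cat bs01 /mkseq -map_comp.
(* The first blocks have equal length in both coordinates, so the equal concatenations split at the
   same place. *)
have bs1E : [seq z i | z <- bs 1] = [seq z j | z <- bs 1].
  have /eqP := etrans (mapE i) (esym (mapE j)).
  by rewrite eqseq_cat ?size_map // => /andP[_ /eqP].
have : pairwise ltn (mkseq u s).
  rewrite -sorted_pairwise; last exact: ltn_trans.
  exact: homo_sorted uhomo _ (iota_ltn_sorted 0 s).
rewrite -(mapE i) pairwise_cat => /andP[/allrelP lt01 _].
by apply: lt01; rewrite ?bs1E.
Qed.

Lemma not_Ramsey_projection_product (I : Type) (c : I -> bool) (i j : I) :
  c i -> ~~ c j ->
  ~ Ramsey_algebra (product_algebra (fun i => projection_algebra (c i))).
Proof.
move=> ci /negbTE cj.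
set P := product_algebra _.
move=> /(_ (fun n _ => n) [set z | (z i : nat) < z j])[a [red_a hom_a]].
have mem_op s : FR (operations P) a (interp P s [tuple a k | k < 2]).
  exact/FR_operation/(@Operation _ P s).
case: hom_a => [sub|disj].
  (* The symbol [false] yields coordinates [a 1 i] and [a 0 j], which lies outside the set; below,
     [true] yields [a 0 i] and [a 1 j], which lies inside. *)
  have := sub _ (mem_op false).
  rewrite /= ci cj !tnth_map !tnth_ord_tuple /=.
  by rewrite ltnNge ltnW // (reduction_diagonal_lt _ _ _ _ _ red_a).
suff : set0 (interp P true [tuple a k | k < 2]) by [].
rewrite -disj; split; first exact: mem_op.
rewrite /= ci cj !tnth_map !tnth_ord_tuple /=.
exact: (reduction_diagonal_lt _ _ _ _ _ red_a).
Qed.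

Theorem theorem4p3 :
  (exists (L : language) (I : finType) (A : I -> algebra L),
     [/\ forall i, infinite_algebra (A i),
         forall i, Ramsey_algebra (A i) &
         ~ Ramsey_algebra (product_algebra A)])
  /\
  (exists (L : language) (I : Type) (A : I -> algebra L),
     [/\ infinite_set [set: I],
         forall i, infinite_algebra (A i),
         forall i, Ramsey_algebra (A i) &
         ~ Ramsey_algebra (product_algebra A)]).
Proof.
split.
  exists two_binary_symbols, bool, projection_algebra; split.
  - by move=> c; exact: infinite_nat.
  - exact: Ramsey_projection_algebra.
  - exact: (@not_Ramsey_projection_product bool id true false).
exists two_binary_symbols, nat, (fun n => projection_algebra (odd n)); split.
- exact: infinite_nat.
- by move=> n; exact: infinite_nat.
- by move=> n; exact: Ramsey_projection_algebra.
- exact: (@not_Ramsey_projection_product nat odd 1 0).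
Qed.
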